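(* Let $\mathfrak{M}$ be an $\mathscr{L}$-structure with infinite domain $M$. Suppose that $\mathfrak{M}$ is uniquely listable, that it has the DPRM property, and that the binary relation $\ne$ is p.e. $\mathscr{L}$-definable over $\mathfrak{M}$. Then $\mathfrak{M}$ has a p.e. $r$-catalogue for every $r\ge1$. In particular, for every $r\ge1$ there is a bound $B_{\mathfrak{M}}(r)$, depending only on $\mathfrak{M}$ and $r$, such that every p.e. $\mathscr{L}$-definable set $X\subseteq M^r$ satisfies $\mathrm{rank}^{p.e.}_{\mathfrak{M}}(X)\le B_{\mathfrak{M}}(r)$.
   Context: All languages contain $=$, interpreted as equality. Listable means recursively enumerable. For $\rho:A\to B$ and $S\subseteq B^r$, $\rho^*(S)$ is the preimage of $S$ under the coordinatewise map $A^r\to B^r$. A listable presentation of $\mathfrak{M}$ is a surjection $\rho:\mathbb{N}\to M$ with $\rho^*(s^{\mathfrak{M}})$ listable for each symbol $s$ (function symbols via their graphs); $X\subseteq M^r$ is totally listable if $\rho^*(X)$ is listable for every listable presentation $\rho$. Presentations $\rho,\gamma$ are equivalent if $\gamma=\rho\circ\phi$ with $\phi:\mathbb{N}\to\mathbb{N}$ total recursive; $\mathfrak{M}$ is uniquely listable if it has a listable presentation and all are equivalent. A formula is positive existential (p.e.) if it uses only atomic formulas, $\wedge$, $\vee$, $\exists$; ''definable'' means without parameters unless said otherwise. DPRM property: every totally listable subset of every $M^r$ is p.e. $\mathscr{L}$-definable. A p.e. $r$-catalogue is a p.e. $\mathscr{L}$-formula $\Upsilon_r[x_0,\dots,x_r]$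 such that for every p.e. $\mathscr{L}$-definable $X\subseteq M^r$ there is $m_X\in M$ with $X=\{\mathbf{a}\in M^r:\mathfrak{M}\models\Upsilon_r[m_X,\mathbf{a}]\}$. For $X\subseteq M^r$ p.e. definable with parameters, $\mathrm{rank}^{p.e.}_{\mathfrak{M}}(X)$ is the least number of existential quantifiers in a p.e. $\mathscr{L}$-formula defining $X$ with parameters from $M$. *)

(* Defs.v *)
From mathcomp Require Import all_boot.
From mathcomp Require Import classical_sets cardinality.

Set Implicit Arguments.
Unset Strict Implicit.
Unset Printing Implicit Defensive.

Local Open Scope classical_set_scope.

(* The power M^n is represented by 'I_n -> M. *)

Definition vcons (T : Type) n (x : T) (v : 'I_n -> T) : 'I_n.+1 -> T :=
  fun i => if unlift ord0 i is Some j then v j else x.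

Definition vcat (T : Type) m n (v : 'I_m -> T) (w : 'I_n -> T) :
    'I_(m + n) -> T :=
  fun i => match split i with inl j => v j | inr j => w j end.

Inductive murec : nat -> Type :=
| MuZero n : murec n
| MuSucc : murec 1
| MuProj n (i : 'I_n) : murec n
| MuComp n k (f : murec k) (g : 'I_k -> murec n) : murec n
| MuPrec n (f : murec n) (g : murec n.+2) : murec n.+1
| MuMin n (f : murec n.+1) : murec n.

(* Primitive recursion on graphs: h(0, v) = f(v), h(m+1, v) = g(m, h(m, v), v). *)
Fixpoint prec_graph n (F : ('I_n -> nat) -> nat -> Prop)
    (G : ('I_n.+2 -> nat) -> nat -> Prop)
    (m : nat) (v : 'I_n -> nat) (y : nat) : Prop :=
  if m is m'.+1 then
    exists2 z, prec_graph F G m' v z & G (vcons m' (vcons z v)) y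
  else F v y.

(* [mu_eval c v y]: the partial function coded by [c] is defined at [v], with
   value [y]. *)
Fixpoint mu_eval n (c : murec n) : ('I_n -> nat) -> nat -> Prop :=
  match c in murec n return ('I_n -> nat) -> nat -> Prop with
  | MuZero n => fun _ y => y = 0
  | MuSucc => fun v y => y = (v ord0).+1
  | MuProj n i => fun v y => y = v i
  | MuComp n k f g => fun v y =>
      exists2 w : 'I_k -> nat, (forall i, mu_eval (g i) v (w i)) & mu_eval f w y
  | MuPrec n f g => fun v y =>
      prec_graph (mu_eval f) (mu_eval g) (v ord0) (v \o lift ord0) y
  | MuMin n f => fun v y =>
      mu_eval f (vcons y v) 0 /\
      (forall z, z < y -> exists w, mu_eval f (vcons z v) w.+1)
  end.

Definition total_recursive (phi : nat -> nat) : Prop :=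
  exists c : murec 1, forall n, mu_eval c (fun=> n) (phi n).

(* Recursively enumerable, as the domain of a partial recursive function. *)
Definition listable r (S : set ('I_r -> nat)) : Prop :=
  exists c : murec r, S = [set v | exists y, mu_eval c v y].

(* Equality is not listed among [rsym]: it is part of every language, and is
   dealt with separately in [pe_formula] and [listable_presentation]. *)
Record language := Language {
  fsym : Type;
  farity : fsym -> nat;
  rsym : Type;
  rarity : rsym -> nat }.

Record structure (L : language) := Structure {
  dom :> Type;
  finterp : forall f : fsym L, ('I_(farity f) -> dom) -> dom;
  rinterp : forall R : rsym L, set ('I_(rarity R) -> dom) }.

Definition eq_rel (T : Type) : set ('I_2 -> T) := [set v | v ord0 = v ord_max].
Definition neq_rel (T : Type) : set ('I_2 -> T) := [set v | v ord0 <> v ord_max].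

(* The value is the last coordinate. *)
Definition graph_of (T : Type) n (F : ('I_n -> T) -> T) : set ('I_n.+1 -> T) :=
  [set v | v ord_max = F (v \o lift ord_max)].

Inductive term (L : language) (n : nat) : Type :=
| Var (i : 'I_n)
| App (f : fsym L) (t : 'I_(farity f) -> term L n).

(* [pe_formula L n]: p.e. formulas with free variables x_0, ..., x_(n-1).
   [PEex] binds x_0 of its body and shifts the other variables down by one. *)
Inductive pe_formula (L : language) (n : nat) : Type :=
| PEeq (s t : term L n)
| PErel (R : rsym L) (t : 'I_(rarity R) -> term L n)
| PEand (phi psi : pe_formula L n)
| PEor (phi psi : pe_formula L n)
| PEex (phi : pe_formula L n.+1).

Fixpoint teval L (M : structure L) n (t : term L n) (v : 'I_n -> M) : M :=
  match t with
  | Var i => v i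
  | App f u => finterp (fun i => teval (u i) v)
  end.

Fixpoint sat L (M : structure L) n (phi : pe_formula L n) :
    ('I_n -> M) -> Prop :=
  match phi with
  | PEeq s t => fun v => teval s v = teval t v
  | PErel R t => fun v => rinterp (fun i => teval (t i) v)
  | PEand p q => fun v => sat p v /\ sat q v
  | PEor p q => fun v => sat p v \/ sat q v
  | PEex p => fun v => exists x : M, sat p (vcons x v)
  end.

Fixpoint nb_exists L n (phi : pe_formula L n) : nat :=
  match phi with
  | PEeq _ _ | PErel _ _ => 0
  | PEand p q | PEor p q => nb_exists p + nb_exists q
  | PEex p => (nb_exists p).+1
  end.

Definition pe_definable L (M : structure L) r (X : set ('I_r -> M)) : Prop :=
  exists phi : pe_formula L r, X = [set a | sat phi a].

(* The last k free variables of phi are instantiated by the parameters b. *)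
Definition pe_definable_with L (M : structure L) r (X : set ('I_r -> M))
    (q : nat) : Prop :=
  exists k (b : 'I_k -> M) (phi : pe_formula L (r + k)),
    X = [set a | sat phi (vcat a b)] /\ nb_exists phi = q.

Definition is_pe_rank L (M : structure L) r (X : set ('I_r -> M))
    (q : nat) : Prop :=
  pe_definable_with X q /\ (forall q', pe_definable_with X q' -> q <= q').

Definition pe_catalogue L (M : structure L) r (Y : pe_formula L r.+1) : Prop :=
  forall X : set ('I_r -> M), pe_definable X ->
    exists m : M, X = [set a | sat Y (vcons m a)].

Definition pullback (A B : Type) (rho : A -> B) r (S : set ('I_r -> B)) :
    set ('I_r -> A) :=
  [set v | S (rho \o v)].

Definition listable_presentation L (M : structure L) (rho : nat -> M) : Prop :=
  [/\ forall x : M, exists n, rho n = x,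
      listable (pullback rho (@eq_rel M)),
      forall f : fsym L, listable (pullback rho (graph_of (@finterp L M f)))
    & forall R : rsym L, listable (pullback rho (@rinterp L M R))].

Definition totally_listable L (M : structure L) r (X : set ('I_r -> M)) : Prop :=
  forall rho : nat -> M, listable_presentation rho -> listable (pullback rho X).

Definition equiv_presentation (T : Type) (rho gamma : nat -> T) : Prop :=
  exists2 phi : nat -> nat, total_recursive phi & gamma = rho \o phi.

Definition uniquely_listable L (M : structure L) : Prop :=
  (exists rho : nat -> M, listable_presentation rho) /\
  (forall rho gamma : nat -> M,
     listable_presentation rho -> listable_presentation gamma ->
     equiv_presentation rho gamma).

Definition dprm_property L (M : structure L) : Prop :=
  forall r, 0 < r -> forall X : set ('I_r -> M),
    totally_listable X -> pe_definable X.

(* Main.v *)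
Require Import Defs.
From mathcomp Require Import all_boot zify.
From mathcomp Require Import boolp classical_sets cardinality.

(** Fix a listable presentation rho. Since = and its complement are listable, the
elements of the infinite set M can be numbered injectively and effectively, by
counting least rho-representatives. Pulled back along rho, every p.e. definable
subset of M^r is recursively enumerable, so the universal r.e. relation, with its
index transported to M by this numbering, is a subset U of M^(r+1) whose sections
include all p.e. definable subsets of M^r. By unique listability the preimage of U
under any other presentation is the preimage of rho^*(U) under a recursive map,
hence U is totally listable, and DPRM turns it into a p.e. formula: the catalogue.
The rank is bounded by the number of quantifiers of the catalogue.

The universal r.e. relation is obtained by evaluating codes of recursive functions:
[f(a) = y] holds iff it belongs to a finite set of such equations each of which is
justified by others in the set. *)

Set Implicit Arguments.
Unset Strict Implicit.
Unset Printing Implicit Defensive.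

Local Open Scope classical_set_scope.

(** * Total computable functions of infinite environments *)

Definition push (x : nat) (w : nat -> nat) : nat -> nat :=
  fun i => if i is j.+1 then w j else x.

Definition shift (w : nat -> nat) : nat -> nat := fun i => w i.+1.

Lemma shift_push x w : shift (push x w) = w.
Proof. by []. Qed.

(* Quantifying over all large arities makes weakening unnecessary. *)
Definition computable (f : (nat -> nat) -> nat) : Prop :=
  exists m0, forall m, m0 <= m ->
    exists c : murec m, forall w : nat -> nat, mu_eval c (fun i => w i) (f w).

Lemma computable_proj i : computable (fun w => w i).
Proof. by exists i.+1 => m lt_im; exists (MuProj (Ordinal lt_im)). Qed.

Lemma computable0 : computable (fun=> 0).
Proof. by exists 0 => m _; exists (MuZero m). Qed.

(** A code for [f] of arity [m0] reads only the first [m0] coordinates, so among the infinitely many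
    arity bounds of the [g i] only finitely many have to be met. *)
Lemma computable_subst f (g : nat -> (nat -> nat) -> nat) :
  computable f -> (forall i, computable (g i)) ->
  computable (fun w => f (g ^~ w)).
Proof.
move=> [m0 /(_ _ (leqnn m0))[c c_f]] /choice[b g_comp].
exists (\max_(i < m0) b i) => m le_m.
have /choice[d d_g] (i : 'I_m0) :
    exists d : murec m, forall w : nat -> nat, mu_eval d (fun i => w i) (g i w).
  by apply: g_comp; apply: leq_trans le_m; apply: (leq_bigmax i).
exists (MuComp c d) => w; exists (fun i => g i w); first by move=> i; apply: d_g.
exact: (c_f (g ^~ w)).
Qed.

Lemma computable_shift f : computable f -> computable (f \o shift).
Proof.
move=> f_comp; apply: (computable_subst (g := fun i w => w i.+1) f_comp) => i.
exact: computable_proj.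
Qed.

Lemma computable_app1 F a :
  computable (fun w => F (w 0)) -> computable a -> computable (fun w => F (a w)).
Proof.
by move=> F_comp a_comp; apply: (computable_subst (g := fun=> a) F_comp).
Qed.

Lemma computable_app2 F a b : computable (fun w => F (w 0) (w 1)) ->
  computable a -> computable b -> computable (fun w => F (a w) (b w)).
Proof.
move=> F_comp a_comp b_comp.
by apply: (computable_subst (g := fun i => if i is 0 then a else b) F_comp)
  => -[|i].
Qed.

Lemma computable_prec f g : computable f -> computable g ->
  computable (fun w => nat_rect (fun=> nat) (f (shift w))
    (fun k r => g (push k (push r (shift w)))) (w 0)).
Proof.
move=> [m1 f_comp] [m2 g_comp].
(* [MuPrec] builds arity [m.+1] from arities [m] and [m.+2], the recursion variable being coordinate
   0; hence the shift of the bound by one. *)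
exists (maxn m1 m2).+1 => -[//|m]; rewrite ltnS geq_max => /andP[le1 le2].
have [c c_f] := f_comp m le1.
have [d d_g] := g_comp m.+2 (leq_trans le2 (leqW (leqnSn m))).
exists (MuPrec c d) => w /=.
have -> : (fun i : 'I_m.+1 => w i) \o lift ord0 = (fun i : 'I_m => shift w i).
  by apply: funext.
elim: (w 0) => [|k IHk] /=; first exact: c_f.
set r := nat_rect _ _ _ _ in IHk *; exists r => //.
have -> : vcons k (vcons r (fun i : 'I_m => shift w i)) =
          (fun i : 'I_m.+2 => push k (push r (shift w)) i).
  apply: funext => i; rewrite /vcons.
  case: unliftP => [j|] -> //=; rewrite /bump /=.
  by case: unliftP => [l|] -> //=.
exact: d_g.
Qed.

(** Reduces to [computable_prec] by pushing the recursion depth [b w] in front of [w], so that the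
    step still sees the whole of [w]. *)
Lemma computable_rec b f g : computable b -> computable f ->
  computable (fun w => g (w 0) (w 1) (shift (shift w))) ->
  computable (fun w => nat_rect (fun=> nat) (f w) (fun k r => g k r w) (b w)).
Proof.
move=> b_comp f_comp g_comp.
apply: (computable_subst (g := fun i => if i is j.+1 then fun w => w j else b)
  (computable_prec f_comp g_comp)) => -[|i] //.
exact: computable_proj.
Qed.

Lemma computableS a : computable a -> computable (fun w => (a w).+1).
Proof.
apply: (@computable_app1 S); exists 1 => m lt0m.
by exists (MuComp MuSucc (fun=> MuProj (Ordinal lt0m))) => w; exists (fun=> w 0).
Qed.

Lemma computable_const n : computable (fun=> n).
Proof. by elim: n => [|n IHn]; [apply: computable0|apply: computableS]. Qed.

Lemma computable_eq f g : f =1 g -> computable f -> computable g.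
Proof. by move=> /funext->. Qed.

Lemma computable_add a b :
  computable a -> computable b -> computable (fun w => a w + b w).
Proof.
move=> a_comp b_comp; apply: (@computable_eq (fun w => nat_rect (fun=> nat) (a w)
  (fun _ r => r.+1) (b w))) => [w|].
  by elim: (b w) => [|n /= ->]; rewrite ?addn0 ?addnS.
by apply: computable_rec => //; apply/computableS/computable_proj.
Qed.

Lemma computable_mul a b :
  computable a -> computable b -> computable (fun w => a w * b w).
Proof.
move=> a_comp b_comp; apply: (@computable_eq (fun w => nat_rect (fun=> nat) 0
  (fun _ r => r + a w) (b w))) => [w|].
  by elim: (b w) => [|n /= ->]; rewrite ?muln0 ?mulnSr.
apply: (@computable_rec _ _ (fun _ r w => r + a w)) => //.
  exact: computable0.
apply: computable_add; first exact: computable_proj.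
exact: computable_shift (computable_shift a_comp).
Qed.

Lemma computable_pred a : computable a -> computable (fun w => (a w).-1).
Proof.
move=> a_comp; apply: (@computable_eq (fun w => nat_rect (fun=> nat) 0
  (fun k _ => k) (a w))) => [w|]; first by case: (a w).
apply: (@computable_rec _ _ (fun k _ _ => k)) => //; first exact: computable0.
exact: computable_proj.
Qed.

Lemma computable_sub a b :
  computable a -> computable b -> computable (fun w => a w - b w).
Proof.
move=> a_comp b_comp; apply: (@computable_eq (fun w => nat_rect (fun=> nat) (a w)
  (fun _ r => r.-1) (b w))) => [w|].
  by elim: (b w) => [|n /= ->]; rewrite ?subn0 ?subnS.
by apply: computable_rec => //; apply/computable_pred/computable_proj.
Qed.

Lemma computable_sum b F : computable b ->
  computable (fun w => F (w 0) (shift w)) ->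
  computable (fun w => \sum_(i < b w) F i w).
Proof.
move=> b_comp F_comp; apply: (@computable_eq (fun w => nat_rect (fun=> nat) 0
  (fun k r => r + F k w) (b w))) => [w|].
  by elim: (b w) => [|n /= ->]; rewrite ?big_ord0 ?big_ord_recr.
apply: (@computable_rec _ _ (fun k r w => r + F k w)) => //.
  exact: computable0.
apply: computable_add; first exact: computable_proj.
(* In the recursion step coordinate 1 holds the accumulator, which [F] must not see. *)
apply: (computable_subst (g := fun i w => if i is j.+1 then w i.+1 else w 0) F_comp).
by case=> *; apply: computable_proj.
Qed.

Lemma computable_prod b F : computable b ->
  computable (fun w => F (w 0) (shift w)) ->
  computable (fun w => \prod_(i < b w) F i w).
Proof.
move=> b_comp F_comp; apply: (@computable_eq (fun w => nat_rect (fun=> nat) 1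
  (fun k r => r * F k w) (b w))) => [w|].
  by elim: (b w) => [|n /= ->]; rewrite ?big_ord0 ?big_ord_recr.
apply: (@computable_rec _ _ (fun k r w => r * F k w)) => //.
  exact: computable_const.
apply: computable_mul; first exact: computable_proj.
apply: (computable_subst (g := fun i w => if i is j.+1 then w i.+1 else w 0) F_comp).
by case=> *; apply: computable_proj.
Qed.

(** * Semidecidable predicates and their closure properties *)

(* Semidecidability in the form "exists u, D u w = 0" with D total: unlike the
   domain of a partial function, it is easily closed under disjunction and
   projection. Monotonicity in u gives closure under bounded quantification. *)
Definition semidec (P : (nat -> nat) -> Prop) : Prop :=
  exists D, [/\ computable D,
    forall u u' w, u <= u' -> D (push u w) = 0 -> D (push u' w) = 0 &
    forall w, P w <-> exists u, D (push u w) = 0].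

Lemma semidec_ext P Q : (forall w, P w <-> Q w) -> semidec P -> semidec Q.
Proof. by move=> PQ; rewrite (_ : P = Q) //; apply: funext => w; apply: propext. Qed.

Lemma semidec_subst P (g : nat -> (nat -> nat) -> nat) :
  semidec P -> (forall i, computable (g i)) -> semidec (fun w => P (g ^~ w)).
Proof.
move=> [D [D_comp D_mono D_P]] g_comp.
pose h i := if i is j.+1 then g j \o shift else fun w : nat -> nat => w 0.
have hE u w : h ^~ (push u w) = push u (g ^~ w) by apply: funext => -[].
exists (fun w => D (h ^~ w)); split.
- apply: computable_subst => // -[|i]; first exact: computable_proj.
  exact: computable_shift.
- by move=> u u' w; rewrite !hE; apply: D_mono.
- by move=> w; rewrite D_P; split=> -[u Du]; exists u; move: Du; rewrite hE.
Qed.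

Lemma semidec_app2 (P : nat -> nat -> Prop) a b :
  semidec (fun w => P (w 0) (w 1)) -> computable a -> computable b ->
  semidec (fun w => P (a w) (b w)).
Proof.
move=> P_sd a_comp b_comp.
by apply: (semidec_subst (g := fun i => if i is 0 then a else b) P_sd) => -[].
Qed.

Lemma semidec_le a b :
  computable a -> computable b -> semidec (fun w => a w <= b w).
Proof.
move=> a_comp b_comp; exists (fun w => a (shift w) - b (shift w)); split=> //.
  exact: computable_shift (computable_sub a_comp b_comp).
move=> w; split=> [|[u /eqP]]; last by rewrite subn_eq0.
by rewrite -subn_eq0 => /eqP; exists 0.
Qed.

Lemma semidec_and P Q : semidec P -> semidec Q -> semidec (fun w => P w /\ Q w).
Proof.
move=> [D [D_comp D_mono D_P]] [E [E_comp E_mono E_Q]].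
exists (fun w => D w + E w); split; first exact: computable_add.
- move=> u u' w le_u /eqP; rewrite addn_eq0 => /andP[/eqP Du /eqP Eu].
  by rewrite (D_mono _ _ _ le_u Du) (E_mono _ _ _ le_u Eu).
- move=> w; rewrite D_P E_Q; split=> [[[u Du] [v Ev]]|[u /eqP]].
    exists (maxn u v); rewrite (D_mono _ _ _ (leq_maxl u v) Du).
    by rewrite (E_mono _ _ _ (leq_maxr u v) Ev).
  by rewrite addn_eq0 => /andP[/eqP Du /eqP Eu]; split; exists u.
Qed.

Lemma semidec_or P Q : semidec P -> semidec Q -> semidec (fun w => P w \/ Q w).
Proof.
move=> [D [D_comp D_mono D_P]] [E [E_comp E_mono E_Q]].
exists (fun w => D w * E w); split; first exact: computable_mul.
- move=> u u' w le_u /eqP; rewrite muln_eq0 => /orP[] /eqP Du.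
    by rewrite (D_mono _ _ _ le_u Du).
  by rewrite (E_mono _ _ _ le_u Du) muln0.
- move=> w; rewrite D_P E_Q; split=> [[[u Du]|[u Du]]|[u /eqP]].
  + by exists u; rewrite Du.
  + by exists u; rewrite Du muln0.
  + by rewrite muln_eq0 => /orP[] /eqP Du; [left|right]; exists u.
Qed.

Lemma semidec_eq a b :
  computable a -> computable b -> semidec (fun w => a w = b w).
Proof.
move=> a_comp b_comp; apply: semidec_ext (semidec_and (semidec_le a_comp b_comp)
  (semidec_le b_comp a_comp)) => w.
by split=> [[le_ab le_ba]|-> //]; apply/eqP; rewrite eqn_leq le_ab.
Qed.

Lemma prod_ord_eq0 n (F : 'I_n -> nat) :
  \prod_(i < n) F i = 0 <-> exists i, F i = 0.
Proof.
split=> [|[i Fi]]; last by rewrite (bigD1 i) //= Fi.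
move=> /eqP; apply: contraPP => /forallNP F_neq0.
by apply/negP; rewrite -lt0n prodn_gt0 // => i; rewrite lt0n; apply/eqP.
Qed.

(** [D] expects the stage before the bound variable, whereas sums and products put their index
    first. *)
Lemma computable_swap D : computable D ->
  computable (fun w => D (push (w 1) (push (w 0) (shift (shift w))))).
Proof.
move=> D_comp.
pose g i w : nat := if i is j.+2 then w i else w (1 - i).
apply: (@computable_eq (fun w => D (g ^~ w))) => [w|].
  by congr D; apply: funext => -[|[]].
by apply: computable_subst => // -[|[|i]]; apply: computable_proj.
Qed.

(** One number [u] serves both as a bound on the witness [x] and as the stage at which [x] is
    tested. The product over [x <= u] vanishes as soon as one factor does. *)
Lemma semidec_ex (P : nat -> (nat -> nat) -> Prop) :
  semidec (fun w => P (w 0) (shift w)) -> semidec (fun w => exists x, P x w).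
Proof.
move=> [D [D_comp D_mono D_P]].
pose E w := \prod_(x < (w 0).+1) D (push (w 0) (push x (shift w))).
have EP u w : E (push u w) = 0 <-> exists2 x, x <= u & D (push u (push x w)) = 0.
  rewrite /E /= shift_push prod_ord_eq0; split=> [[i]|[x le_xu]].
    by exists i; rewrite // -ltnS.
  by rewrite -ltnS in le_xu; exists (Ordinal le_xu).
exists E; split.
- apply: (computable_prod (F := fun x w => D (push (w 0) (push x (shift w))))).
    exact/computableS/computable_proj.
  exact: computable_swap.
- move=> u u' w le_u /EP[x le_xu Dx]; apply/EP.
  by exists x; [apply: leq_trans le_u|apply: D_mono Dx].
- move=> w; split=> [[x /(D_P (push x w))[u Du]]|[u /EP[x _ Dx]]].
    by exists (maxn x u); apply/EP; exists x; rewrite ?leq_maxl //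
      (D_mono _ _ _ (leq_maxr x u) Du).
  by exists x; apply/(D_P (push x w)); exists u.
Qed.

(** A sum vanishes when all its terms do. Each [x] succeeds at a stage of its own, and by
    monotonicity the maximum of these finitely many stages works for all. *)
Lemma semidec_ball b (P : nat -> (nat -> nat) -> Prop) :
  computable b -> semidec (fun w => P (w 0) (shift w)) ->
  semidec (fun w => forall x, x < b w -> P x w).
Proof.
move=> b_comp [D [D_comp D_mono D_P]].
pose E w := \sum_(x < b (shift w)) D (push (w 0) (push x (shift w))).
have EP u w : E (push u w) = 0 <-> forall x, x < b w -> D (push u (push x w)) = 0.
  rewrite /E /= shift_push; split=> [/eqP|D0]; last first.
    by apply: big1 => i _; apply: D0.
  rewrite sum_nat_eq0 => /forallP D0 x lt_xb.
  exact/eqP/(implyP (D0 (Ordinal lt_xb))).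
exists E; split.
- apply: (computable_sum (F := fun x w => D (push (w 0) (push x (shift w))))).
    exact: computable_shift.
  exact: computable_swap.
- move=> u u' w le_u /EP D0; apply/EP => x lt_xb.
  exact: D_mono le_u (D0 x lt_xb).
- move=> w; split=> [Pw|[u /EP D0] x lt_xb]; last first.
    by apply/(D_P (push x w)); exists u; apply: D0.
  have /choice[u Du] (x : 'I_(b w)) : exists u, D (push u (push x w)) = 0.
    by apply/(D_P (push x w)); apply: (Pw x).
  exists (\max_x u x); apply/EP => x lt_xb.
  exact: D_mono (leq_bigmax (Ordinal lt_xb)) (Du (Ordinal lt_xb)).
Qed.

Lemma semidec_bex b (P : nat -> (nat -> nat) -> Prop) :
  computable b -> semidec (fun w => P (w 0) (shift w)) ->
  semidec (fun w => exists2 x, x < b w & P x w).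
Proof.
move=> b_comp P_sd.
apply: (@semidec_ext (fun w => exists x, x < b w /\ P x w)) => [w|].
  by split=> -[x]; [case|]; exists x.
apply: (semidec_ex (P := fun x w => x < b w /\ P x w)); apply: semidec_and => //.
by apply: semidec_le; [apply/computableS/computable_proj|apply: computable_shift].
Qed.

(** The tests for the various [P i] need not be uniform in [i], so this is an iterated conjunction
    rather than a case of [semidec_ball]. *)
Lemma semidec_all_ord k (P : 'I_k -> (nat -> nat) -> Prop) :
  (forall i, semidec (P i)) -> semidec (fun w => forall i, P i w).
Proof.
elim: k P => [|k IHk] P P_sd.
  apply: (@semidec_ext (fun=> 0 <= 0)) => [w|]; first by split=> // _ [].
  by apply: semidec_le; apply: computable0.
apply: (@semidec_ext (fun w => P ord0 w /\ forall i, P (lift ord0 i) w)) => [w|].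
  by split=> [[P0 PS] i|Pw]; [case: (unliftP ord0 i) => [j|] ->|split].
by apply: semidec_and => //; apply: IHk.
Qed.

(** * From semidecidable predicates to listable sets *)

Definition extend n (v : 'I_n -> nat) : nat -> nat :=
  fun i => if insub i is Some j then v j else 0.

Lemma extendE n (v : 'I_n -> nat) (i : 'I_n) : extend v i = v i.
Proof. by rewrite /extend valK. Qed.

Lemma extend_out n (v : 'I_n -> nat) i : n <= i -> extend v i = 0.
Proof. by move=> le_ni; rewrite /extend insubF // ltnNge le_ni. Qed.

Lemma computable_extend f n : computable f ->
  exists c : murec n, forall v, mu_eval c v (f (extend v)).
Proof.
move=> [m /(_ m (leqnn m))[c c_f]].
(* The code [c] may have an arity different from [n]; surplus inputs receive 0, in agreement with
   the padding in [extend]. *)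
pose d (i : 'I_m) : murec n :=
  if insub (val i) is Some j then MuProj j else MuZero n.
exists (MuComp c d) => v; exists (fun i => extend v i); last exact: c_f.
by move=> i; rewrite /d /extend; case: insub.
Qed.

Lemma mu_eval_fun n (c : murec n) v y z : mu_eval c v y -> mu_eval c v z -> y = z.
Proof.
elim: c v y z => {n} [n|  |n i|n k f IHf g IHg|n f IHf g IHg|n f IHf] v y z /=.
- by move=> -> ->.
- by move=> -> ->.
- by move=> -> ->.
- move=> [w gw fw] [w' gw' fw']; apply: IHf fw _; rewrite (_ : w = w') //.
  by apply: funext => i; apply: IHg (gw i) (gw' i).
- move: (v \o _) => u; elim: (v ord0) y z => [|m IHm] y z /=; first exact: IHf.
  by move=> [p p_m py] [q /(IHm _ _ p_m) <-]; apply: IHg.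
- move=> [fy lt_y] [fz lt_z]; case: (ltngtP y z) => // [/lt_z|/lt_y] [w].
    by move=> /(IHf _ _ _ fy).
  by move=> /(IHf _ _ _ fz).
Qed.

(** The partial function searches for the least stage at which [D] vanishes. Since [D] is total, the
    values at earlier stages are defined and positive, as [MuMin] demands. *)
Lemma semidec_listable r (S : set ('I_r -> nat)) (P : (nat -> nat) -> Prop) :
  semidec P -> (forall v, S v <-> P (extend v)) -> listable S.
Proof.
move=> [D [D_comp _ D_P]] S_P; have [c c_D] := computable_extend r.+1 D_comp.
have c_push u (v : 'I_r -> nat) : mu_eval c (vcons u v) (D (push u (extend v))).
  rewrite (_ : push u (extend v) = extend (vcons u v)) //; apply: funext => -[|i].
    by rewrite -[0]/(val (@ord0 r)) extendE /vcons unlift_none.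
  case: (ltnP i r) => [lt_ir|le_ri]; last by rewrite /= !extend_out.
  rewrite -[i.+1]/(val (lift ord0 (Ordinal lt_ir))) extendE /vcons liftK.
  by rewrite /= -[i]/(val (Ordinal lt_ir)) extendE.
exists (MuMin c); apply/seteqP; split=> v /=.
  move=> /S_P /D_P[u Du].
  have ex_u : exists u, D (push u (extend v)) == 0 by exists u; apply/eqP.
  case: (ex_minnP ex_u) => y /eqP Dy y_min; exists y; split.
    by rewrite -Dy; apply: c_push.
  move=> z lt_zy; exists (D (push z (extend v))).-1; rewrite prednK //.
  by rewrite lt0n; apply: contraTN lt_zy => /y_min; rewrite -leqNgt.
move=> [y [c0 _]]; apply/S_P/D_P; exists y.
exact: mu_eval_fun (c_push y v) c0.
Qed.

(** * Coding of pairs and vectors *)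

(* Pairs are coded by c = (x + y)^2 + x; [root c] is then x + y. *)
Definition root (c : nat) : nat := \sum_(i < c) (1 - (i.+1 * i.+1 - c)).
Definition hd (c : nat) : nat := c - root c * root c.
Definition tl (c : nat) : nat := root c - hd c.

(** With [s = x + y], the code [c] lies between [s * s] and [s.+1 * s.+1], the latter excluded.
    Truncated subtraction makes each summand of [root] the indicator of [i.+1 * i.+1 <= c], that is
    of [i < s]; as [s <= c], the sum is [s]. *)
Lemma root_pair x y : root ((x + y) * (x + y) + x) = x + y.
Proof.
set s := x + y; set c := s * s + x; rewrite /root.
have bit_le (i : 'I_c) : 1 - (i.+1 * i.+1 - c) = (i < s).
  have [lt_is|le_si] := ltnP i s; rewrite /c.
    have /eqP -> : i.+1 * i.+1 - (s * s + x) == 0.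
      by rewrite subn_eq0; apply: leq_trans (leq_addr _ _); apply: leq_mul.
    by [].
  have lt_ssi : s * s + x < i.+1 * i.+1.
    apply: (@leq_trans (s.+1 * s.+1)); last exact: leq_mul.
    by have := leq_addr y x; rewrite -/s; nia.
  by move: lt_ssi; rewrite -subn_gt0; case: (_ - _).
have le_sc : s <= c by rewrite /c /s; nia.
rewrite (eq_bigr _ (fun i _ => bit_le i)) -(big_mkord xpredT (fun i => (i < s) : nat)).
rewrite (@big_cat_nat _ _ _ s) //= [X in _ + X]big1_seq ?addn0 => [|i]; last first.
  by rewrite mem_index_iota /= => /andP[le_si _]; rewrite ltnNge le_si.
rewrite (eq_big_nat _ _ (F2 := fun=> 1)) => [|i /andP[_ ->]] //.
by rewrite sum_nat_const_nat subn0 muln1.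
Qed.

Lemma pair_ex x y : exists c, hd c = x /\ tl c = y.
Proof.
exists ((x + y) * (x + y) + x); rewrite /tl /hd !root_pair addKn.
by split; rewrite // addKn.
Qed.

(** Nested pairs code sequences without storing a length: every number has digits at all
    positions. *)
Definition dig (c i : nat) : nat := hd (iter i tl c).

Lemma dig0 c : dig c 0 = hd c.
Proof. by []. Qed.

Lemma digS c i : dig c i.+1 = dig (tl c) i.
Proof. by rewrite /dig iterSr. Qed.

Lemma dig_ex k (u : nat -> nat) : exists c, forall i, i < k -> dig c i = u i.
Proof.
elim: k u => [|k IHk] u; first by exists 0.
have [c c_u] := IHk (fun i => u i.+1); have [d [d_hd d_tl]] := pair_ex (u 0) c.
by exists d => -[|i] lt_ik; rewrite ?digS ?d_tl ?c_u.
Qed.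

(** A relation, because only the first [n] digits are prescribed and a vector therefore has many
    codes. *)
Definition vector_code n (a : nat) (v : 'I_n -> nat) : Prop :=
  forall i : 'I_n, dig a i = v i.

Lemma vector_code_ex n (v : 'I_n -> nat) : exists a, vector_code a v.
Proof.
by have [a a_v] := dig_ex n (extend v); exists a => i; rewrite a_v ?extendE.
Qed.

Lemma vector_code_cons n a x (v : 'I_n -> nat) :
  vector_code a (vcons x v) <-> hd a = x /\ vector_code (tl a) v.
Proof.
split=> [a_v|[a_x a_v] i].
  split=> [|i]; first by rewrite -dig0 (a_v ord0) /vcons unlift_none.
  by rewrite -digS (a_v (lift ord0 i)) /vcons liftK.
by rewrite /vcons; case: unliftP => [j|] ->; rewrite ?digS //= a_v.
Qed.

Lemma computable_root a : computable a -> computable (fun w => root (a w)).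
Proof.
apply: computable_app1.
apply: (computable_sum (F := fun i w => 1 - (i.+1 * i.+1 - w 0))).
  exact: computable_proj.
apply: computable_sub; first exact: computable_const.
apply: computable_sub; last exact: computable_proj.
by apply: computable_mul; apply/computableS/computable_proj.
Qed.

Lemma computable_hd a : computable a -> computable (fun w => hd (a w)).
Proof.
move=> a_comp; apply: computable_sub => //.
by apply: computable_mul; apply: computable_root.
Qed.

Lemma computable_tl a : computable a -> computable (fun w => tl (a w)).
Proof.
by move=> a_comp; apply: computable_sub; [apply: computable_root|apply: computable_hd].
Qed.

Lemma computable_dig a b :
  computable a -> computable b -> computable (fun w => dig (a w) (b w)).
Proof.
apply: (@computable_app2 dig); apply: computable_hd.
apply: (@computable_rec _ _ (fun _ r _ => tl r)) => //.
- exact: computable_proj.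
- exact: computable_proj.
- exact: computable_tl (computable_proj 1).
Qed.

Ltac computability := cbv [shift]; repeat first
  [ assumption
  | match goal with
    | |- computable (fun w => w _) => apply: computable_proj
    | |- computable (fun _ => ?n) => apply: computable_const
    | |- computable (fun w => (@?a w).+1) => apply: (@computableS a)
    | |- computable (fun w => @?a w + @?b w) => apply: (@computable_add a b)
    | |- computable (fun w => dig (@?a w) (@?b w)) => apply: (@computable_dig a b)
    | |- computable (fun w => hd (@?a w)) => apply: (@computable_hd a)
    | |- computable (fun w => tl (@?a w)) => apply: (@computable_tl a)
    end ].

(** Recursion on the syntax of the predicate by second-order matching. Unfolding [shift] keeps
    variables in the form [w i]; atoms without a rule are left as goals. *)
Ltac semidecidability := cbv beta delta [shift]; repeat first
  [ assumption
  | match goal with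
    | |- semidec (fun w => @?P w /\ @?Q w) => refine (@semidec_and P Q _ _)
    | |- semidec (fun w => @?P w \/ @?Q w) => refine (@semidec_or P Q _ _)
    | |- semidec (fun w => @?a w = @?b w) => refine (@semidec_eq a b _ _)
    | |- semidec (fun w => is_true (@?a w < @?b w)) =>
        refine (@semidec_le (fun w => (a w).+1) b _ _)
    | |- semidec (fun w => exists x, @?P w x) =>
        refine (@semidec_ex (fun x w => P w x) _)
    | |- semidec (fun w => forall x, is_true (x < @?b w) -> @?P w x) =>
        refine (@semidec_ball b (fun x w => P w x) _ _)
    | |- semidec (fun w => exists2 x, is_true (x < @?b w) & @?P w x) =>
        refine (@semidec_bex b (fun x w => P w x) _ _)
    end; cbv beta delta [shift]
  | progress computability ].

(** * Codes of recursive functions, derivations and the universal relation *)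

(** Digit 0 is a tag for the constructor. A composition also records [k], since [justified] sees
    only numbers and must know how many inner values to check. *)
Fixpoint murec_code n (c : murec n) (e : nat) : Prop :=
  match c with
  | MuZero _ => dig e 0 = 0
  | MuSucc => dig e 0 = 1
  | MuProj _ i => dig e 0 = 2 /\ dig e 1 = i
  | MuComp _ k f g => dig e 0 = 3 /\ murec_code f (dig e 1) /\ dig e 2 = k /\
      forall i : 'I_k, murec_code (g i) (dig (dig e 3) i)
  | MuPrec _ f g =>
      dig e 0 = 4 /\ murec_code f (dig e 1) /\ murec_code g (dig e 2)
  | MuMin _ f => dig e 0 = 5 /\ murec_code f (dig e 1)
  end.

Lemma murec_code_ex n (c : murec n) : exists e, murec_code c e.
Proof.
have dig4_ex a b c' d : exists e,
    [/\ dig e 0 = a, dig e 1 = b, dig e 2 = c' & dig e 3 = d].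
  by have [e e_s] := dig_ex 4 (nth 0 [:: a; b; c'; d]); exists e; rewrite !e_s.
elim: c => {n} [n|  |n i|n k f [ef IHf] g /choice[eg IHg]|n f [ef IHf] g [eg IHg]|
  n f [ef IHf]] /=.
- by have [e []] := dig4_ex 0 0 0 0; exists e.
- by have [e []] := dig4_ex 1 0 0 0; exists e.
- by have [e []] := dig4_ex 2 i 0 0; exists e.
- have [b b_eg] := vector_code_ex eg.
  have [e [e0 e1 e2 e3]] := dig4_ex 3 ef k b; exists e; rewrite e0 e1 e2 e3.
  by split=> //; split=> //; split=> // i; rewrite b_eg.
- by have [e [e0 e1 e2 _]] := dig4_ex 4 ef eg 0; exists e; rewrite e0 e1 e2.
- by have [e [e0 e1 _ _]] := dig4_ex 5 ef 0 0; exists e; rewrite e0 e1.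
Qed.

(* [T e a y] reads: the function with code e maps the vector with code a to y.
   A set of such triples whose members are justified by members of the same set
   contains only true ones, by induction on the coded function; so derivations
   need not be ordered. *)
Definition justified (T : nat -> nat -> nat -> Prop) (e a y : nat) : Prop :=
  dig e 0 = 0 /\ y = 0 \/
  dig e 0 = 1 /\ y = (hd a).+1 \/
  dig e 0 = 2 /\ y = dig a (dig e 1) \/
  dig e 0 = 3 /\ (exists b, T (dig e 1) b y /\
    forall i, i < dig e 2 -> T (dig (dig e 3) i) a (dig b i)) \/
  dig e 0 = 4 /\ hd a = 0 /\ T (dig e 1) (tl a) y \/
  dig e 0 = 4 /\ (exists a1 a2, T e a1 (hd (tl a2)) /\ hd a = (hd a1).+1 /\
    tl a1 = tl a /\ T (dig e 2) a2 y /\ hd a2 = hd a1 /\ tl (tl a2) = tl a) \/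
  dig e 0 = 5 /\ (exists a1, T (dig e 1) a1 0 /\ hd a1 = y /\ tl a1 = a) /\
    (forall z, z < y -> exists a1 u,
      T (dig e 1) a1 u.+1 /\ hd a1 = z /\ tl a1 = a).

(** [T] occurs only positively in [justified]; this is what allows derivations to be merged. *)
Lemma justified_mono (T T' : nat -> nat -> nat -> Prop) e a y :
  (forall e a y, T e a y -> T' e a y) -> justified T e a y -> justified T' e a y.
Proof.
move=> TT'; rewrite /justified => -[?|[?|[?|[[? [b [? Tg]]]|[[? [? ?]]|[[? [a1 [a2]]]|]]]]]].
- by left.
- by right; left.
- by do 2!right; left.
- do 3!right; left; split=> //; exists b; split; first exact: TT'.
  by move=> i /Tg /TT'.
- by do 4!right; left; split=> //; split=> //; apply: TT'.
- move=> [/TT' ? [? [? [/TT' ? [? ?]]]]].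
  by do 5!right; left; split=> //; exists a1, a2.
- move=> [? [[a1 [/TT' ? [? ?]]] Tz]]; do 6!right; do 2!split=> //; first by exists a1.
  by move=> z /Tz[b [u [/TT' ? ?]]]; exists b, u.
Qed.

Lemma justified_sound (T : nat -> nat -> nat -> Prop) :
  (forall e a y, T e a y -> justified T e a y) ->
  forall n (c : murec n) e a v y,
    murec_code c e -> vector_code a v -> T e a y -> mu_eval c v y.
Proof.
move=> T_just n; elim=> {n} [n|  |n i|n k f IHf g IHg|n f IHf g IHg|n f IHf]
  e a v y /=.
(* Once the tag is known, the alternatives with another tag are contradictory. *)
- move=> tag a_v /T_just; rewrite /justified tag.
  by case=> [[_ ->]|[[]|[[]|[[]|[[]|[[]|[]]]]]]].
- move=> tag a_v /T_just; rewrite /justified tag -dig0 (a_v ord0).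
  by case=> [[]|[[_ ->]|[[]|[[]|[[]|[[]|[]]]]]]].
- move=> [tag e1] a_v /T_just; rewrite /justified tag e1 (a_v i).
  by case=> [[]|[[]|[[_ ->]|[[]|[[]|[[]|[]]]]]]].
- move=> [tag [e1 [e2 e3]]] a_v /T_just; rewrite /justified tag e2.
  case=> [[]|[[]|[[]|[[_ [b [Tf Tg]]]|[[]|[[]|[]]]]]]] //.
  exists (fun i => dig b i); last exact: IHf Tf.
  by move=> i; apply: IHg (e3 i) a_v (Tg i (ltn_ord i)).
- move=> [tag [e1 e2]] a_v Ty.
  have a0 : hd a = v ord0 by rewrite -dig0 (a_v ord0).
  have: vector_code (tl a) (v \o lift ord0).
    by move=> i; rewrite -digS (a_v (lift ord0 i)).
  (* The successor alternative refers back to the same code [e], so the induction on [c] needs an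
     inner induction on the recursion variable [m]. *)
  move: (v \o lift ord0) (v ord0) a0 => u m {a_v}.
  elim: m a y Ty => [|m IHm] a y /T_just; rewrite /justified tag.
    move=> + a0 a_u; case=> [[]|[[]|[[]|[[]|[[_ [_ Tf]]|[[_]|[]]]]]]] //.
      exact: IHf Tf.
    by rewrite a0 => -[a1 [a2 [_ []]]].
  move=> + a0 a_u; rewrite a0.
  case=> [[]|[[]|[[]|[[]|[[_ []]|[[_ [a1 [a2]]]|[]]]]]]] //.
  move=> [Ta1 [[m_a1] [tl_a1 [Ta2 [hd_a2 tl_a2]]]]].
  exists (hd (tl a2)); first by apply: IHm Ta1 _ _ => //; rewrite tl_a1.
  apply: IHg e2 _ Ta2; apply/vector_code_cons; split; first by rewrite hd_a2.
  by apply/vector_code_cons; rewrite tl_a2.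
- move=> [tag e1] a_v /T_just; rewrite /justified tag.
  case=> [[]|[[]|[[]|[[]|[[]|[[]|[_ [[a1 [Ta1 [hd_a1 tl_a1]]] Tz]]]]]]]] //.
  split; first by apply: IHf Ta1 => //; apply/vector_code_cons; rewrite tl_a1.
  move=> z /Tz[b [u [Tb [hd_b tl_b]]]]; exists u.
  by apply: IHf Tb => //; apply/vector_code_cons; rewrite tl_b.
Qed.

Definition mem_triple (l : seq (nat * nat * nat)) : nat -> nat -> nat -> Prop :=
  fun e a y => (e, a, y) \in l.

Definition derivation (l : seq (nat * nat * nat)) : Prop :=
  forall e a y, mem_triple l e a y -> justified (mem_triple l) e a y.

Definition derivable (e a y : nat) : Prop :=
  exists l, derivation l /\ mem_triple l e a y.

Lemma derivation_cat l1 l2 :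
  derivation l1 -> derivation l2 -> derivation (l1 ++ l2).
Proof.
move=> l1_der l2_der e a y; rewrite {1}/mem_triple mem_cat => /orP[/l1_der|/l2_der];
  by apply: justified_mono => ? ? ?; rewrite /mem_triple mem_cat => ->; rewrite ?orbT.
Qed.

Lemma derivable_step l e a y :
  derivation l -> justified (mem_triple l) e a y -> derivable e a y.
Proof.
move=> l_der l_just; exists ((e, a, y) :: l); split; last exact: mem_head.
have sub_l e' a' y' : mem_triple l e' a' y' -> mem_triple ((e, a, y) :: l) e' a' y'.
  by rewrite /mem_triple inE => ->; rewrite orbT.
move=> e' a' y'; rewrite {1}/mem_triple inE => /orP[/eqP[-> -> ->]|/l_der].
  exact: justified_mono l_just.
exact: justified_mono.
Qed.

(** [P] constrains a triple without fixing it: for minimisation, the positive values below [y] are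
    not given in advance. *)
Lemma derivable_all k (P : nat -> nat * nat * nat -> Prop) :
  (forall i, i < k -> exists e a y, derivable e a y /\ P i (e, a, y)) ->
  exists l, derivation l /\
    forall i, i < k -> exists e a y, mem_triple l e a y /\ P i (e, a, y).
Proof.
elim: k => [_|k IHk P_der]; first by exists [::].
have [i lt_ik|l [l_der l_P]] := IHk; first exact: P_der (ltnW lt_ik).
have [e [a [y [[l' [l'_der l'_eay]] P_eay]]]] := P_der k (leqnn _).
exists (l ++ l'); split; first exact: derivation_cat.
move=> i; rewrite ltnS leq_eqVlt => /predU1P[->|/l_P[e' [a' [y' [l_e' P_e']]]]].
  by exists e, a, y; rewrite /mem_triple mem_cat; split=> //; apply/orP; right.
by exists e', a', y'; rewrite /mem_triple mem_cat; split=> //; apply/orP; left.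
Qed.

(** By induction on [c]: concatenate derivations of the subcomputations and add the conclusion. *)
Lemma derivable_complete n (c : murec n) e a v y :
  murec_code c e -> vector_code a v -> mu_eval c v y -> derivable e a y.
Proof.
have catl l l' x : mem_triple l x.1.1 x.1.2 x.2 ->
    mem_triple (l ++ l') x.1.1 x.1.2 x.2.
  by rewrite /mem_triple mem_cat => ->.
have catr l l' x : mem_triple l' x.1.1 x.1.2 x.2 ->
    mem_triple (l ++ l') x.1.1 x.1.2 x.2.
  by rewrite /mem_triple mem_cat orbC => ->.
elim: c e a v y => {n} [n|  |n i|n k f IHf g IHg|n f IHf g IHg|n f IHf] e a v y /=.
- by move=> tag _ ->; apply: (@derivable_step [::]) => //; left.
- move=> tag a_v ->; apply: (@derivable_step [::]) => //; right; left.
  by rewrite -dig0 (a_v ord0).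
- move=> [tag e1] a_v ->; apply: (@derivable_step [::]) => //; do 2!right; left.
  by rewrite e1 a_v.
- move=> [tag [e1 [e2 e3]]] a_v [w gw fw]; have [b b_w] := vector_code_ex w.
  have [l [l_der l_f]] := IHf _ _ _ _ e1 b_w fw.
  have [i lt_ik|l' [l'_der l'_g]] :=
      @derivable_all k (fun i x => x = (dig (dig e 3) i, a, dig b i)).
    exists (dig (dig e 3) i), a, (dig b i); split=> //.
    rewrite -[i]/(val (Ordinal lt_ik)) b_w.
    exact: IHg (e3 _) a_v (gw _).
  apply: (derivable_step (derivation_cat l_der l'_der)); do 3!right; left.
  split=> //; exists b; split; first exact: (catl l l' (_, _, _)).
  move=> i; rewrite e2 => /l'_g[e' [a' [y' [l'_e' [<- <- <-]]]]].
  exact: (catr l l' (_, _, _)).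
- move=> [tag [e1 e2]] a_v.
  have a0 : hd a = v ord0 by rewrite -dig0 (a_v ord0).
  have: vector_code (tl a) (v \o lift ord0).
    by move=> i; rewrite -digS (a_v (lift ord0 i)).
  move: (v \o lift ord0) (v ord0) a0 => u m {a_v}.
  elim: m a y => [|m IHm] a y a0 a_u /=.
    move=> /(IHf _ _ _ _ e1 a_u)[l [l_der l_f]].
    by apply: (derivable_step l_der); do 4!right; left.
  (* With [u] the remaining arguments, [a1] codes [m, u], the input of the previous call, and [a2]
     codes [m, z, u], the input of [g]. *)
  move=> [z zm gy]; have [a1 [hd_a1 tl_a1]] := pair_ex m (tl a).
  have [a2' [hd_a2' tl_a2']] := pair_ex z (tl a).
  have [a2 [hd_a2 tl_a2]] := pair_ex m a2'.
  have [|l [l_der l_e]] := IHm a1 z hd_a1 _ zm; first by rewrite tl_a1.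
  have [|l' [l'_der l'_g]] := IHg _ a2 _ _ e2 _ gy.
    apply/vector_code_cons; split=> //; rewrite tl_a2.
    by apply/vector_code_cons; rewrite tl_a2'.
  apply: (derivable_step (derivation_cat l_der l'_der)); do 5!right; left.
  split=> //; exists a1, a2; rewrite tl_a2 hd_a1 hd_a2 hd_a2' tl_a1 tl_a2' a0.
  by do !split=> //; [apply: (catl l l' (_, _, _))|apply: (catr l l' (_, _, _))].
- move=> [tag e1] a_v [fy fz]; have [a1 [hd_a1 tl_a1]] := pair_ex y a.
  have [|l [l_der l_f]] := IHf _ a1 _ _ e1 _ fy.
    by apply/vector_code_cons; rewrite tl_a1.
  have [z lt_zy|l' [l'_der l'_f]] := @derivable_all y (fun z x =>
      x.1.1 = dig e 1 /\ hd x.1.2 = z /\ tl x.1.2 = a /\ 0 < x.2).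
    have [u fu] := fz z lt_zy; have [b [hd_b tl_b]] := pair_ex z a.
    exists (dig e 1), b, u.+1; split=> //; apply: IHf e1 _ fu.
    by apply/vector_code_cons; rewrite tl_b.
  apply: (derivable_step (derivation_cat l_der l'_der)); do 6!right.
  split=> //; split; first by exists a1; split=> //; apply: (catl l l' (_, _, _)).
  move=> z /l'_f[e' [b [u [l'_e' /= [e'E [hd_b [tl_b u_gt0]]]]]]].
  exists b, u.-1; rewrite prednK // -e'E; split=> //.
  exact: (catr l l' (_, _, _)).
Qed.

(** A number [t] codes a finite set of triples: [hd t] is the length of the list, and each digit of
    [tl t] is a nested pair [e, (a, y)]. *)
Definition stated (t e a y : nat) : Prop :=
  exists2 i, i < hd t & hd (dig (tl t) i) = e /\
    hd (tl (dig (tl t) i)) = a /\ tl (tl (dig (tl t) i)) = y.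

Definition certificate (t : nat) : Prop :=
  forall i, i < hd t -> justified (stated t) (hd (dig (tl t) i))
    (hd (tl (dig (tl t) i))) (tl (tl (dig (tl t) i))).

Definition universal (e a : nat) : Prop :=
  exists t, certificate t /\ exists y, stated t e a y.

Lemma stated_ex l : exists t, stated t = mem_triple l.
Proof.
have /choice[s s_l] (x : nat * nat * nat) : exists s,
    hd s = x.1.1 /\ hd (tl s) = x.1.2 /\ tl (tl s) = x.2.
  have [d [hd_d tl_d]] := pair_ex x.1.2 x.2; have [s [hd_s tl_s]] := pair_ex x.1.1 d.
  by exists s; rewrite tl_s.
have [c c_l] := dig_ex (size l) (fun i => s (nth (0, 0, 0) l i)).
have [t [hd_t tl_t]] := pair_ex (size l) c; exists t.
apply: funext => e; apply: funext => a; apply: funext => y; apply: propext.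
rewrite /stated /mem_triple hd_t tl_t; split=> [[i lt_il]|].
  rewrite c_l //; have := s_l (nth (0, 0, 0) l i).
  have := mem_nth (0, 0, 0) lt_il; case: (nth _ _ _) => -[e' a'] y' l_i.
  by move=> [-> [-> ->]] [<- [<- <-]].
move=> /(nthP (0, 0, 0))[i lt_il l_i]; exists i => //.
by rewrite c_l // l_i; apply: s_l.
Qed.

Lemma universalP n (c : murec n) e a v : murec_code c e -> vector_code a v ->
  universal e a <-> exists y, mu_eval c v y.
Proof.
move=> c_e a_v; split=> [[t [t_cert [y t_eay]]]|[y cvy]].
  exists y; apply: justified_sound c_e a_v t_eay => _ _ _ [i lt_it [<- [<- <-]]].
  exact: t_cert.
have [l [l_der l_eay]] := derivable_complete c_e a_v cvy.
have [t tE] := stated_ex l; exists t; split; last by exists y; rewrite tE.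
by move=> i lt_it; rewrite tE; apply: l_der; rewrite -tE; exists i.
Qed.

(** Unfolded, [universal] has only existential and bounded universal quantifiers over computable
    equations and inequalities, so the closure rules suffice. *)
Lemma semidec_universal a b :
  computable a -> computable b -> semidec (fun w => universal (a w) (b w)).
Proof.
apply: semidec_app2.
rewrite /universal /certificate /justified /stated; semidecidability.
Qed.

Lemma listable_universal r (X : set ('I_r -> nat)) : listable X ->
  exists e, forall a v, vector_code a v -> X v <-> universal e a.
Proof.
move=> [c ->]; have [e c_e] := murec_code_ex c; exists e => a v a_v.
by rewrite (universalP c_e a_v).
Qed.

(** Converse to [semidec_listable]: searching for a certificate replaces the partial function by a
    total test. *)
Lemma listable_semidec r (X : set ('I_r -> nat)) (f : 'I_r -> (nat -> nat) -> nat) :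
  listable X -> (forall i, computable (f i)) -> semidec (fun w => X (f ^~ w)).
Proof.
move=> /listable_universal[e X_e] f_comp.
apply: (@semidec_ext (fun w => exists a, (forall i : 'I_r, dig a i = f i w) /\
  universal e a)) => [w|].
  split=> [[a [a_f]]|Xf]; first by rewrite -(X_e _ (f ^~ w)).
  by have [a a_f] := vector_code_ex (f ^~ w); exists a; rewrite -(X_e _ _ a_f).
apply: (semidec_ex (P := fun a w => (forall i : 'I_r, dig a i = f i w) /\ _ a)).
apply: semidec_and; last by apply: semidec_universal; computability.
apply: semidec_all_ord => i; apply: semidec_eq; first by computability.
exact: computable_shift.
Qed.

(** * Definable and totally listable sets under presentations *)

Lemma semidec_pullback2 (T : Type) (rho : nat -> T) (E : set ('I_2 -> T))
    (R : T -> T -> Prop) a b :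
  (forall v, E v <-> R (v ord0) (v ord_max)) -> listable (pullback rho E) ->
  computable a -> computable b -> semidec (fun w => R (rho (a w)) (rho (b w))).
Proof.
move=> E_R E_list a_comp b_comp.
pose f (i : 'I_2) := if val i is 0 then a else b.
apply: semidec_ext (listable_semidec (f := f) E_list _) => [w|i].
  by rewrite /pullback /= E_R.
by rewrite /f; case: (val i).
Qed.

Lemma semidec_presented_eq L (M : structure L) rho a b :
  listable_presentation (M := M) rho -> computable a -> computable b ->
  semidec (fun w => rho (a w) = rho (b w)).
Proof. by move=> [_ eq_list _ _]; apply: semidec_pullback2 eq_list. Qed.

(** The elements [F i w] are accessible only through the relation of being named by a number. Guess
    names for all of them at once, coded by [z], and test these names; they exist because [rho] is
    onto. *)
Lemma listable_semidec_tuple (T : Type) (rho : nat -> T) k (X : set ('I_k -> T))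
    (F : 'I_k -> (nat -> nat) -> T) :
  (forall x, exists n, rho n = x) -> listable (pullback rho X) ->
  (forall i, semidec (fun w => rho (w 0) = F i (shift w))) ->
  semidec (fun w => X (F ^~ w)).
Proof.
move=> rho_surj X_list F_sd.
apply: (@semidec_ext (fun w => exists z, (forall i : 'I_k, rho (dig z i) = F i w) /\
    X (fun i => rho (dig z i)))) => [w|].
  split=> [[z [z_F]]|XF]; first by rewrite (funext z_F).
  have /choice[u u_F] i := rho_surj (F i w).
  have [z z_u] := vector_code_ex u; exists z.
  have z_F (i : 'I_k) : rho (dig z i) = F i w by rewrite z_u.
  by split; rewrite ?(funext z_F).
refine (@semidec_ex (fun z w => (forall i : 'I_k, rho (dig z i) = F i w) /\
    X (fun i => rho (dig z i))) _).
apply: semidec_and; last first.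
  apply: (listable_semidec (f := fun i w => dig (w 0) i) X_list) => i.
  by computability.
apply: semidec_all_ord => i.
apply: (semidec_subst (g := fun j w => if j is 0 then dig (w 0) i else w j) (F_sd i)).
by case=> [|j]; computability.
Qed.

Lemma semidec_teval L (M : structure L) rho n (t : term L n)
    (f : 'I_n -> (nat -> nat) -> nat) b :
  listable_presentation (M := M) rho -> (forall i, computable (f i)) ->
  computable b -> semidec (fun w => rho (b w) = teval t (fun i => rho (f i w))).
Proof.
move=> rho_pres; elim: t f b => [i|g u IHu] f b f_comp b_comp /=.
  exact: semidec_presented_eq.
have [rho_surj _ graph_list _] := rho_pres.
(* The arguments of the function symbol followed by its value, in the order of [graph_of]. *)
pose F j w := if unlift ord_max j is Some i
  then teval (u i) (fun i => rho (f i w)) else rho (b w).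
apply: semidec_ext (listable_semidec_tuple (F := F) rho_surj (graph_list g) _).
  move=> w; rewrite /graph_of /= {1}/F unlift_none.
  rewrite (_ : F ^~ w \o _ = fun i => teval (u i) (fun i => rho (f i w))) //.
  by apply: funext => i; rewrite /F /= liftK.
move=> j; rewrite /F; case: unliftP => [i|] _.
  apply: (IHu i (fun i w => f i (shift w))) => [k|]; last exact: computable_proj.
  exact: computable_shift.
apply: semidec_presented_eq => //; first exact: computable_proj.
exact: computable_shift.
Qed.

Lemma semidec_sat L (M : structure L) rho n (phi : pe_formula L n)
    (f : 'I_n -> (nat -> nat) -> nat) :
  listable_presentation (M := M) rho -> (forall i, computable (f i)) ->
  semidec (fun w => sat phi (fun i => rho (f i w))).
Proof.
move=> rho_pres; have [rho_surj _ _ rel_list] := rho_pres.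
elim: phi f => {n} [n s t|n R t|n p IHp q IHq|n p IHp q IHq|n p IHp] f f_comp /=.
(* An equation between terms holds when their values share a name [z]. *)
- apply: (@semidec_ext (fun w => exists z, rho z = teval s (fun i => rho (f i w)) /\
      rho z = teval t (fun i => rho (f i w)))) => [w|].
    split=> [[z [<-]]//|st]; have [z z_s] := rho_surj (teval s (fun i => rho (f i w))).
    by exists z; rewrite -st.
  refine (@semidec_ex (fun z w => rho z = teval s (fun i => rho (f i w)) /\
    rho z = teval t (fun i => rho (f i w))) _).
  by apply: semidec_and;
    apply: (@semidec_teval _ _ _ _ _ (fun i w => f i (shift w))) => // [i|]; [apply: computable_shift|apply: computable_proj
          |apply: computable_shift|apply: computable_proj].
- apply: (listable_semidec_tuple (F := fun i w => teval (t i) (fun i => rho (f i w))))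
    => // i.
  apply: (@semidec_teval _ _ _ _ _ (fun i w => f i (shift w))) => // [j|].
    exact: computable_shift.
  exact: computable_proj.
- by apply: semidec_and; [apply: IHp|apply: IHq].
- by apply: semidec_or; [apply: IHp|apply: IHq].
- pose g (j : 'I_n.+1) w := if unlift ord0 j is Some i then f i (shift w) else w 0.
  have g_cons w : vcons (rho (w 0)) (fun i => rho (f i (shift w))) =
      (fun j => rho (g j w)).
    by apply: funext => j; rewrite /vcons /g; case: unlift.
  (* Surjectivity of [rho] turns a quantifier over [M] into one over names. *)
  apply: (@semidec_ext (fun w => exists x, sat p (vcons (rho x)
      (fun i => rho (f i w))))) => [w|].
    split=> [[x px]|[x]]; first by exists (rho x).
    by have [y <-] := rho_surj x; exists y.
  refine (@semidec_ex (fun x w => sat p (vcons (rho x) (fun i => rho (f i w)))) _).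
  apply: (@semidec_ext (fun w => sat p (fun j => rho (g j w)))) => [w|].
    by rewrite -g_cons.
  apply: IHp => j; rewrite /g; case: unlift => [i|]; last exact: computable_proj.
  exact: computable_shift.
Qed.

Lemma pe_definable_listable L (M : structure L) rho r (X : set ('I_r -> M)) :
  listable_presentation (M := M) rho -> pe_definable X -> listable (pullback rho X).
Proof.
move=> rho_pres [phi ->].
apply: (semidec_listable (P := fun w => sat phi (fun i : 'I_r => rho (w i)))) => [|v].
  by apply: (@semidec_sat _ _ _ _ _ (fun i w => w i)) => // i; apply: computable_proj.
by rewrite /pullback /=; under [X in _ <-> sat _ X]funext => i do rewrite extendE.
Qed.

Lemma total_recursive_computable phi a :
  total_recursive phi -> computable a -> computable (fun w => phi (a w)).
Proof.
move=> [c c_phi]; apply: computable_app1; exists 1 => m m_gt0.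
by exists (MuComp c (fun=> MuProj (Ordinal m_gt0))) => w; exists (fun=> w 0).
Qed.

(** Since [gamma = rho \o phi], substituting the recursive [phi] into a test for names under [rho]
    gives one for names under [gamma]. *)
Lemma semidec_totally_listable L (M : structure L) rho r (X : set ('I_r -> M)) :
  uniquely_listable M -> listable_presentation (M := M) rho ->
  semidec (fun w => X (fun i => rho (w i))) -> totally_listable X.
Proof.
move=> [_ M_unique] rho_pres X_sd gamma gamma_pres.
have [phi phi_rec ->] := M_unique _ _ rho_pres gamma_pres.
apply: (semidec_listable (P := fun w => X (fun i => rho (phi (w i))))) => [|v].
  apply: (semidec_subst (g := fun i w => phi (w i)) X_sd) => i.
  exact/total_recursive_computable/computable_proj.
rewrite /pullback /=.
by under [X in _ <-> _ X]funext => i do rewrite extendE.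
Qed.

(** * Effective injective numbering of the domain *)

(* Numbering of the classes of [rho x = rho y] by the naturals: the n-th class is
   the n-th one in the order of least representatives. *)
Definition least_repr (T : Type) (rho : nat -> T) (n : nat) : Prop :=
  forall m, m < n -> rho m <> rho n.

Definition nb_least (T : Type) (rho : nat -> T) (n : nat) : nat :=
  \sum_(i < n) `[< least_repr rho i >].

Definition class_index (T : Type) (rho : nat -> T) (n k : nat) : Prop :=
  exists m, rho m = rho n /\ least_repr rho m /\ nb_least rho m = k.

Lemma least_repr_ex (T : Type) (rho : nat -> T) n :
  exists m, [/\ m <= n, rho m = rho n & least_repr rho m].
Proof.
have ex_m : exists m, `[< rho m = rho n >] by exists n; apply/asboolP.
case: (ex_minnP ex_m) => m /asboolP m_n m_min; exists m; split=> //.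
  by apply: m_min; apply/asboolP.
move=> i lt_im; rewrite m_n => /asboolP /m_min.
by rewrite leqNgt lt_im.
Qed.

(** Rewrites the negation as a bounded existential statement about equality, which is
    semidecidable. *)
Lemma least_reprN (T : Type) (rho : nat -> T) n :
  ~ least_repr rho n <-> exists2 m, m < n & rho m = rho n.
Proof.
split=> [not_least|[m lt_mn m_n] /(_ m lt_mn)//].
have [m [le_mn m_n m_least]] := least_repr_ex rho n; exists m => //.
by rewrite ltn_neqAle le_mn andbT; apply: contra_notN not_least => /eqP <-.
Qed.

Lemma class_index_fun (T : Type) (rho : nat -> T) n k k' :
  class_index rho n k -> class_index rho n k' -> k = k'.
Proof.
move=> [m [m_n [m_least <-]]] [m' [m'_n [m'_least <-]]]; rewrite -m'_n in m_n.
by case: (ltngtP m m') => [/m'_least|/m_least|->//] /(_ _); rewrite m_n.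
Qed.

Lemma nb_leastS (T : Type) (rho : nat -> T) n :
  nb_least rho n.+1 = nb_least rho n + `[< least_repr rho n >].
Proof. by rewrite /nb_least big_ord_recr. Qed.

(** Least representatives exist beyond every [N], as otherwise [rho] would map a finite segment onto
    [T]. The count stays constant up to the next one and then grows by one, so it takes every
    value. *)
Lemma class_index_surj (T : Type) (rho : nat -> T) :
  infinite_set [set: T] -> (forall x, exists n, rho n = x) ->
  forall k, exists n, class_index rho n k.
Proof.
move=> T_inf rho_surj.
have unbounded N : exists n, N <= n /\ least_repr rho n.
  apply: contrapT => /forallNP no_least; apply: T_inf.
  apply: (@sub_finite_set _ _ (rho @` `I_N)); last exact/finite_image/finite_II.
  move=> x _; have [n <-] := rho_surj x.
  have [m [_ m_n m_least]] := least_repr_ex rho n; exists m => //=.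
  by rewrite ltnNge; apply/negP => le_Nm; apply: (no_least m).
have next N : exists n, least_repr rho n /\ nb_least rho n = nb_least rho N.
  have ex_n : exists n, (N <= n) && `[< least_repr rho n >].
    by have [n [le_Nn /asboolP n_least]] := unbounded N; exists n; rewrite le_Nn.
  case: (ex_minnP ex_n) => n /andP[le_Nn /asboolP n_least] n_min.
  exists n; split=> //; rewrite -(subnKC le_Nn).
  have: N + (n - N) <= n by rewrite subnKC.
  elim: (n - N) => [|d IHd]; rewrite ?addn0 // addnS nb_leastS => lt_dn.
  rewrite IHd ?(ltnW lt_dn) //.
  case: (asboolP (least_repr rho (N + d))) => [/asboolP d_least|_]; last exact: addn0.
  have := n_min (N + d); rewrite leq_addr d_least.
  by rewrite leqNgt lt_dn => /(_ isT).
suff surj k : exists n, least_repr rho n /\ nb_least rho n = k.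
  by move=> k; have [n [n_least n_k]] := surj k; exists n, n.
elim: k => [|k [n [n_least n_k]]].
  by have [n [n_least n_0]] := next 0; exists n; rewrite n_0 /nb_least big_ord0.
have [m [m_least m_n]] := next n.+1; exists m; split=> //.
by rewrite m_n nb_leastS n_k (asboolT n_least) addn1.
Qed.

(** The number [z] codes the history of the count. Each step asserts either [least_repr] or its
    negation, hence the two hypotheses. *)
Lemma semidec_nb_least (T : Type) (rho : nat -> T) :
  semidec (fun w => least_repr rho (w 0)) ->
  semidec (fun w => ~ least_repr rho (w 0)) ->
  semidec (fun w => nb_least rho (w 0) = w 1).
Proof.
move=> least_sd not_least_sd.
apply: (@semidec_ext (fun w => exists z, dig z 0 = 0 /\ dig z (w 0) = w 1 /\
  forall i, i < w 0 -> least_repr rho i /\ dig z i.+1 = (dig z i).+1 \/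
    ~ least_repr rho i /\ dig z i.+1 = dig z i)) => [w|].
  split=> [[z [z0 [<- zS]]]|<-].
    elim: (w 0) zS => [|n IHn] zS; first by rewrite z0 /nb_least big_ord0.
    rewrite nb_leastS IHn => [|i lt_in]; last exact: zS (ltnW lt_in).
    by have [[/asboolT-> ->]|[/asboolF-> ->]] := zS n (leqnn _); rewrite ?addn1 ?addn0.
  have [z z_nb] := dig_ex (w 0).+1 (nb_least rho).
  exists z; rewrite !z_nb // /nb_least big_ord0; do 2!split=> //.
  move=> i lt_in; rewrite !z_nb ?(ltnW lt_in) // ?leqW // nb_leastS.
  have [least_i|not_least_i] := asboolP (least_repr rho i); last first.
    by right; rewrite addn0.
  by left; rewrite addn1.
by semidecidability.
Qed.

(** Being least is a bounded conjunction of inequations and failing to be least uses equations: this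
    is where listability of both relations enters. *)
Lemma semidec_class_index (T : Type) (rho : nat -> T) :
  (forall a b, computable a -> computable b ->
    semidec (fun w => rho (a w) = rho (b w))) ->
  (forall a b, computable a -> computable b ->
    semidec (fun w => rho (a w) <> rho (b w))) ->
  semidec (fun w => class_index rho (w 0) (w 1)).
Proof.
move=> eq_sd neq_sd.
have least_sd : semidec (fun w => least_repr rho (w 0)).
  by rewrite /least_repr; semidecidability; apply: neq_sd; computability.
have not_least_sd : semidec (fun w => ~ least_repr rho (w 0)).
  apply: (@semidec_ext (fun w => exists2 m, m < w 0 & rho m = rho (w 0))) => [w|].
    exact: iff_sym (least_reprN _ _).
  by semidecidability; apply: eq_sd; computability.
rewrite /class_index.
refine (@semidec_ex (fun m w => rho m = rho (w 0) /\ _) _).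
apply: semidec_and; first by apply: eq_sd; computability.
apply: semidec_and; first exact: least_sd.
apply: (@semidec_app2 (fun m k => nb_least rho m = k)); [|by computability..].
exact: semidec_nb_least.
Qed.

(** * Construction of the catalogue *)

Lemma pe_catalogue_ex L (M : structure L) r : infinite_set [set: M] ->
  uniquely_listable M -> dprm_property M -> pe_definable (@neq_rel M) ->
  exists Y : pe_formula L r.+1, pe_catalogue M Y.
Proof.
move=> M_inf M_unique M_dprm M_neq.
have [[rho rho_pres] _] := M_unique; have [rho_surj _ _ _] := rho_pres.
have eq_sd a b := @semidec_presented_eq _ _ _ a b rho_pres.
have neq_sd a b : computable a -> computable b ->
    semidec (fun w => rho (a w) <> rho (b w)).
  exact: (@semidec_pullback2 _ rho (@neq_rel M) (fun x y => x <> y) a b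
    (fun=> iff_refl _) (pe_definable_listable rho_pres M_neq)).
(* The class index [k] of coordinate 0 is read as the code of a recursive function, applied to names
   of the other coordinates. *)
pose U : set ('I_r.+1 -> M) := [set v | exists n k a, rho n = v ord0 /\
  class_index rho n k /\ (forall i : 'I_r, rho (dig a i) = v (lift ord0 i)) /\
  universal k a].
have [Y UY] : pe_definable U.
  apply: M_dprm => //; apply: (semidec_totally_listable M_unique rho_pres).
  rewrite /U /=; semidecidability.
  - by apply: eq_sd; computability.
  - by apply: (semidec_app2 (semidec_class_index eq_sd neq_sd)); computability.
  - by apply: semidec_all_ord => i; apply: eq_sd; computability.
  - by apply: semidec_universal; computability.
exists Y => X X_def.
have [e X_e] := listable_universal (pe_definable_listable rho_pres X_def).
(* The catalogue parameter for [X] is the element whose class index is the code [e] of [X]. *)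
have [n n_e] := class_index_surj M_inf rho_surj e.
exists (rho n); apply: funext => a; apply: propext.
have sat_Y v : sat Y v <-> U v by rewrite UY.
rewrite /= sat_Y.
have a0 : vcons (rho n) a ord0 = rho n by rewrite /vcons unlift_none.
have aS i : vcons (rho n) a (lift ord0 i) = a i by rewrite /vcons liftK.
split=> [Xa|[n' [k [d [n'_n [n'_k [d_a d_k]]]]]]].
  have /choice[u u_a] i := rho_surj (a i); have [d d_u] := vector_code_ex u.
  exists n, e, d; rewrite a0; do !split=> //; first by move=> i; rewrite aS d_u.
  by apply/(X_e d u) => //; rewrite /pullback /= (funext u_a : rho \o u = a).
(* The name [n'] may differ from [n], but it names the same element, and the index depends only on
   the class. *)
have k_e : k = e.
  apply: class_index_fun n'_k _; rewrite a0 in n'_n.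
  by have [m [m_n m_least]] := n_e; exists m; rewrite n'_n.
(* [d] trivially codes the vector of its own digits, which are names of [a]. *)
rewrite k_e in d_k; have /(_ (fun=> erefl))/iffRL/(_ d_k) := X_e d (fun i => dig d i).
by rewrite /pullback /= (_ : rho \o _ = a) //; apply: funext => i /=; rewrite d_a aS.
Qed.

(** * Renaming of variables and the rank bound *)

Fixpoint term_rename L n m (s : 'I_n -> 'I_m) (t : term L n) : term L m :=
  match t with
  | Var i => Var L (s i)
  | App f u => App (fun i => term_rename s (u i))
  end.

Definition lift_renaming n m (s : 'I_n -> 'I_m) (j : 'I_n.+1) : 'I_m.+1 :=
  if unlift ord0 j is Some i then lift ord0 (s i) else ord0.

Fixpoint pe_rename L n m (s : 'I_n -> 'I_m) (phi : pe_formula L n) :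
    pe_formula L m :=
  match phi with
  | PEeq u t => PEeq (term_rename s u) (term_rename s t)
  | PErel R t => PErel (fun i => term_rename s (t i))
  | PEand p q => PEand (pe_rename s p) (pe_rename s q)
  | PEor p q => PEor (pe_rename s p) (pe_rename s q)
  | PEex p => PEex (pe_rename (lift_renaming s) p)
  end.

Lemma teval_rename L (M : structure L) n m (s : 'I_n -> 'I_m) (t : term L n)
    (v : 'I_m -> M) : teval (term_rename s t) v = teval t (v \o s).
Proof. by elim: t => //= f u IHu; congr finterp; apply: funext. Qed.

Lemma vcons_lift_renaming (T : Type) n m (s : 'I_n -> 'I_m) (v : 'I_m -> T) x :
  vcons x v \o lift_renaming s = vcons x (v \o s).
Proof.
apply: funext => j; rewrite /vcons /lift_renaming /=.
by case: (unlift ord0 j) => [i|]; rewrite ?liftK ?unlift_none.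
Qed.

Lemma sat_rename L (M : structure L) n m (s : 'I_n -> 'I_m) (phi : pe_formula L n)
    (v : 'I_m -> M) : sat (pe_rename s phi) v = sat phi (v \o s).
Proof.
elim: phi m s v => {n} [n u t|n R t|n p IHp q IHq|n p IHp q IHq|n p IHp] m s v /=.
- by rewrite !teval_rename.
- by congr rinterp; apply: funext => i; apply: teval_rename.
- by rewrite IHp IHq.
- by rewrite IHp IHq.
- by congr ex; apply: funext => x; rewrite IHp vcons_lift_renaming.
Qed.

Lemma pe_rank_le L (M : structure L) r (X : set ('I_r -> M)) q :
  pe_definable_with X q -> exists2 p, is_pe_rank X p & p <= q.
Proof.
move=> X_q; have ex_p : exists p, `[< pe_definable_with X p >].
  by exists q; apply/asboolP.
case: (ex_minnP ex_p) => p /asboolP X_p p_min; exists p.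
  by split=> // q' /asboolP /p_min.
by apply: p_min; apply/asboolP.
Qed.

(** One formula defines all the sets; only its parameter varies with [X], so its number of
    quantifiers is a uniform bound. *)
Lemma catalogue_rank_bound L (M : structure L) r (Y : pe_formula L r.+1) :
  pe_catalogue M Y ->
  exists B, forall X : set ('I_r -> M), pe_definable X ->
    exists2 q, is_pe_rank X q & q <= B.
Proof.
(* The catalogue has its index first, whereas [pe_definable_with] expects parameters last. *)
pose s (j : 'I_r.+1) : 'I_(r + 1) :=
  if unlift ord0 j is Some i then lshift 1 i else rshift r ord0.
move=> Y_cat; exists (nb_exists (pe_rename s Y)) => X /Y_cat[m ->].
apply: pe_rank_le; exists 1, (fun=> m), (pe_rename s Y); split=> //.
apply: funext => a; rewrite /= sat_rename; congr sat; apply: funext => j.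
rewrite /vcons /vcat /s /=; case: (unlift ord0 j) => [i|].
  by rewrite (unsplitK (inl i)).
by rewrite (unsplitK (inr ord0)).
Qed.

Theorem theorem4p6 (L : language) (M : structure L)
    (M_infinite : infinite_set [set: M])
    (M_uniquely_listable : uniquely_listable M)
    (M_dprm : dprm_property M)
    (M_neq : pe_definable (@neq_rel M)) :
  (forall r : nat, 0 < r ->
     exists Y : pe_formula L r.+1, @pe_catalogue L M r Y) /\
  (forall r : nat, 0 < r ->
     exists B : nat, forall X : set ('I_r -> M), pe_definable X ->
       exists2 q : nat, is_pe_rank X q & q <= B).
Proof.
split=> r _; first exact: pe_catalogue_ex.
have [Y Y_cat] : exists Y : pe_formula L r.+1, pe_catalogue M Y.
  exact: pe_catalogue_ex.
exact: catalogue_rank_bound Y_cat.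
Qed.
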